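(* Let $K$ be an infinite field, $k\ge1$, $\vec s=(n_1,\dots,n_k)$ a tuple of positive integers, $n=\min(n_1,\dots,n_k)-1$. Embed $\operatorname{Gr}(\vec s)$ into a projective space via the composition $\Sigma$ of the Plücker embeddings $\iota_p:\operatorname{Gr}(K'_p(\vec s),C_p)\hookrightarrow\mathbb P(\Lambda^{K'_p(\vec s)}C_p)$ of the factors followed by the Segre embedding of the product. Then the image $\Sigma(\mathbf{Gr}^{\mathrm{simp}}(\vec s))$ is the intersection of $\Sigma(\operatorname{Gr}(\vec s))$ with a linear subspace of the ambient projective space.
   Context: Notation: $[p]=\{0,\dots,p\}$. Put $M_a(p)=n_a-1-n+p$ (so $M_a(p)\ge p$) and $I_p=\prod_{a=1}^k[M_a(p)]$ for $p\ge 0$. Let $\delta_i^q:[q-1]\to[q]$ be the increasing injection missing $i$ and $\sigma_i^q:[q+1]\to[q]$ the nondecreasing surjection taking the value $i$ twice. $I_\bullet$ is the functor from the simplicial category to sets with $I_\bullet([p])=I_p$, $I_\bullet(\delta_i^p)=\prod_{a}\delta_i^{M_a(p)}:I_{p-1}\to I_p$ and $I_\bullet(\sigma_i^p)=\prod_a\sigma_i^{M_a(p)}:I_{p+1}\to I_p$. $C_\bullet=K[\boldsymbol\Delta^n]$ is the simplicial $K$-vector space with $C_p$ having as basis the nondecreasing maps $\alpha:[p]\to[n]$, with $d_i(\alpha)=\alpha\circ\delta_i^p$; $S_p=\dim C_p=\binom{n+p+1}{p+1}$. For a function $T:I_n\to K$ let $M_{T,p}$ be the matrix with rows indexed by $m\in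 I_p$, columns by nondecreasing maps $\alpha:[p]\to[n]$, and entries $T(I_\bullet(\alpha)(m))$. The generic rank $R'_p(\vec s)$ is the rank of this matrix over the function field $K(v_u:u\in I_n)$ when $T$ has independent indeterminate entries $T(u)=v_u$; and $K'_p(\vec s)=S_p-R'_p(\vec s)$. $\operatorname{Gr}(r,V)$ is the Grassmannian of $r$-dimensional subspaces of $V$; $\operatorname{Gr}(\vec s)=\prod_{0\le p\le n,\ K'_p(\vec s)>0}\operatorname{Gr}(K'_p(\vec s),C_p)$. The incidence variety $\mathbf{Gr}^{\mathrm{simp}}(\vec s)\subset\operatorname{Gr}(\vec s)$ is the closed subvariety of tuples $(L_p)_p$ satisfying $d_i(L_p)\subseteq L_{p-1}$ for all $1\le p\le n$, $0\le i\le p$ with $K'_p(\vec s)>0$ (with $L_{p-1}=0$ if $K'_{p-1}(\vec s)=0$). *)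

(* Defs.v *)
From HB Require Import structures.
From mathcomp Require Import all_boot all_order all_fingroup all_algebra.
From mathcomp Require Import mpoly.
From mathcomp Require Import zify.

Set Implicit Arguments.
Unset Strict Implicit.
Unset Printing Implicit Defensive.

Import GRing.Theory.
Local Open Scope nat_scope.

Definition infinite_type (T : eqType) : Prop := ~ exists r : seq T, r =i predT.

Definition nondecreasing_fun p q (f : {ffun 'I_p.+1 -> 'I_q.+1}) : bool :=
  [forall i : 'I_p.+1, forall j : 'I_p.+1, (i <= j) ==> (f i <= f j)].

(* The morphisms [p] -> [q] of the simplicial category, [p] = {0, ..., p} *)
Record mono (p q : nat) := Mono {
  mono_fun :> {ffun 'I_p.+1 -> 'I_q.+1};
  _ : nondecreasing_fun mono_fun }.

HB.instance Definition _ p q := [isSub for @mono_fun p q].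
HB.instance Definition _ p q := [Finite of mono p q by <:].

Lemma monoP p q (f : mono p q) (i j : 'I_p.+1) : i <= j -> f i <= f j.
Proof. by case: f => f /= /forallP/(_ i)/forallP/(_ j)/implyP. Qed.

Fact mono_comp_subproof p q r (g : mono q r) (f : mono p q) :
  nondecreasing_fun [ffun i => g (f i)].
Proof.
apply/forallP=> i; apply/forallP=> j; apply/implyP=> le_ij.
by rewrite !ffunE; do 2!apply: monoP.
Qed.
Definition mono_comp p q r (g : mono q r) (f : mono p q) : mono p r :=
  Mono (mono_comp_subproof g f).

Fact mono_id_subproof p : nondecreasing_fun [ffun i : 'I_p.+1 => i].
Proof.
by apply/forallP=> i; apply/forallP=> j; apply/implyP=> le_ij; rewrite !ffunE.
Qed.
Definition mono_id p : mono p p := Mono (mono_id_subproof p).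

Fact coface_subproof q (i : 'I_q.+2) :
  nondecreasing_fun [ffun j : 'I_q.+1 => lift i j].
Proof.
apply/forallP=> j; apply/forallP=> l; apply/implyP=> le_jl.
by rewrite !ffunE /= leq_bump2.
Qed.
(* [coface i] is delta_i^(q+1) : [q] -> [q+1] *)
Definition coface q (i : 'I_q.+2) : mono q q.+1 := Mono (coface_subproof i).

Fact codegen_ord_subproof q (i : 'I_q.+1) (j : 'I_q.+2) : unbump i j < q.+1.
Proof.
rewrite /unbump; have := ltn_ord i; have := ltn_ord j.
by case: (ltnP i j) => [|le_ji _ lt_i]; rewrite ?subn0 ?subn1 ?(leq_ltn_trans le_ji) //;
   case: (nat_of_ord j).
Qed.
Fact codegen_subproof q (i : 'I_q.+1) :
  nondecreasing_fun [ffun j : 'I_q.+2 => Ordinal (codegen_ord_subproof i j)].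
Proof.
apply/forallP=> j; apply/forallP=> l; apply/implyP=> le_jl.
rewrite !ffunE /= /unbump.
case: (ltnP i j) => [lt_ij|le_ji]; first by rewrite (leq_trans lt_ij le_jl) leq_sub2r.
case: (ltnP i l) => [lt_il|_]; last by rewrite !subn0.
by rewrite subn0 subn1 -ltnS (leq_ltn_trans le_ji) // prednK // (leq_ltn_trans _ lt_il).
Qed.
(* [codegen i] is sigma_i^q : [q+1] -> [q] *)
Definition codegen q (i : 'I_q.+1) : mono q.+1 q := Mono (codegen_subproof i).

Lemma mono_eqP p q (f g : mono p q) :
  (forall i : 'I_p.+1, f i = g i :> nat) -> f = g.
Proof. by move=> fg; apply/val_inj/ffunP=> i; apply/val_inj/fg. Qed.

Lemma mono_gen_ind (P : forall p q, mono p q -> Prop) :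
  (forall p, P p p (mono_id p)) ->
  (forall p q r (g : mono q r) (f : mono p q),
     P q r g -> P p q f -> P p r (mono_comp g f)) ->
  (forall q (i : 'I_q.+2), P q q.+1 (coface i)) ->
  (forall q (i : 'I_q.+1), P q.+1 q (codegen i)) ->
  forall p q (f : mono p q), P p q f.
Proof.
move=> Pid Pcomp Pcoface Pcodegen p q.
have [N] := ubnP (p + q); elim: N p q => // N IHN p q lt_pqN f.
case: (boolP [exists i, i \notin codom f]) => [/existsP[i nfi]|].
  have nf j : f j != i by apply: contraNneq nfi => <-; apply: codom_f.
  case: q => [|q] in lt_pqN f i {nfi} nf *.
    by case/eqP: (nf ord0); rewrite !ord1.
  pose i' : 'I_q.+1 := inord (minn i q).
  have -> : f = mono_comp (coface i) (mono_comp (codegen i') f).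
    apply: mono_eqP => j; rewrite !ffunE /= inordK ?ltnS ?geq_minr //.
    have := nf j; rewrite -val_eqE /=; have := ltn_ord (f j); have := ltn_ord i.
    by rewrite /bump /unbump; lia.
  by apply: (Pcomp) => //; apply: IHN; move: lt_pqN; rewrite addnS.
rewrite negb_exists => /forallP f_onto.
case: (boolP [exists i : 'I_p, f (inord i) == f (inord i.+1)]) => [/existsP[i]|].
  case: p => [|p] in lt_pqN f f_onto i *; first by case: i.
  move/eqP=> eq_fi.
  have -> : f = mono_comp (mono_comp f (coface (inord i : 'I_p.+2))) (codegen i).
    apply: mono_eqP => j; rewrite !ffunE /=; congr (nat_of_ord _).
    have [-> | ne_ji] := eqVneq j (inord i).
      rewrite eq_fi; congr (f _); apply/val_inj => /=.
      by rewrite !inordK /bump /unbump ?ltnn ?subn0 ?leqnn //; have := ltn_ord i; lia.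
    congr (f _); apply/val_inj => /=.
    have := ltn_ord i; have := ltn_ord j.
    move: ne_ji; rewrite -val_eqE /= !inordK; last by have := ltn_ord i; lia.
    by rewrite /bump /unbump; lia.
  by apply: (Pcomp) => //; apply: IHN; move: lt_pqN; rewrite addSn.
rewrite negb_exists => /forallP f_step.
have f_lt (i j : 'I_p.+1) : i < j -> f i < f j.
  move=> lt_ij; have lt_ip : i < p by have := ltn_ord j; lia.
  have := f_step (Ordinal lt_ip); rewrite -val_eqE /= inord_val.
  have := @monoP _ _ f i (inord i.+1); have := @monoP _ _ f (inord i.+1) j.
  by rewrite inordK //; lia.
have f_inj : injective f.
  move=> i j eq_f; apply/val_inj; have := f_lt i j; have := f_lt j i.
  by rewrite eq_f ltnn /=; lia.
have eq_pq : p = q.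
  have : #|codom f| = #|'I_q.+1|.
    by apply: eq_card => i; have := f_onto i; rewrite negbK inE.
  by rewrite card_codom // !card_ord => -[].
clear IHN lt_pqN f_onto f_step f_inj; case: q / eq_pq f f_lt => f f_lt.
suff -> : f = mono_id p by [].
apply: mono_eqP => i; rewrite ffunE; apply/eqP; rewrite eqn_leq; apply/andP; split.
  have [m] := ubnP (p - i); elim: m i => // m IHm i lt_m.
  case: (ltnP i p) => [lt_ip|le_pi]; last by have := ltn_ord (f i); lia.
  have := IHm (inord i.+1); have := f_lt i (inord i.+1).
  by rewrite inordK //; lia.
case: i => i lt_i /=; elim: i lt_i => // i IHi lt_i.
have lt_i' : i < p.+1 by apply: ltnW.
by have := IHi lt_i'; have := f_lt (Ordinal lt_i') (Ordinal lt_i) (ltnSn i); lia.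
Qed.

(* The extension of alpha : [p] -> [q] to [p + c] -> [q + c] that shifts the
   last c elements.  It is functorial and sends the generators delta_i^q and
   sigma_i^q to delta_i^(q+c) and sigma_i^(q+c).  By [Imap_id], [Imap_comp],
   [Imap_coface], [Imap_codegen] and [Imap_unique] below, [Imap] is the only
   functor with the prescribed values on the generators. *)
Definition extend_nat p q (alpha : mono p q) (j : nat) : nat :=
  if j <= p then nat_of_ord (alpha (inord j)) else j - p + q.

Lemma extend_subproof p q c (alpha : mono p q) (j : 'I_(p + c).+1) :
  extend_nat alpha j < (q + c).+1.
Proof.
rewrite /extend_nat ltnS; case: (leqP j p) => [_|lt_pj].
  by apply: (@leq_trans q); rewrite ?leq_addr // -ltnS.
by rewrite addnC leq_add2l leq_subLR -ltnS.
Qed.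
Definition extend p q c (alpha : mono p q) (j : 'I_(p + c).+1) : 'I_(q + c).+1 :=
  Ordinal (extend_subproof alpha j).

Section Format.
Variables (k : nat) (s : k.-tuple nat).

(* n = min(n_1, ..., n_k) - 1 *)
Definition top_dim : nat := (\big[minn/head 0 s]_(m <- s) m).-1.

(* M_a(p) = n_a - 1 - n + p *)
Definition Mtop (a : 'I_k) (p : nat) : nat := p + ((tnth s a).-1 - top_dim).

Definition Iset (p : nat) := {dffun forall a : 'I_k, 'I_(Mtop a p).+1}.
HB.instance Definition _ p := Finite.on (Iset p).

Definition Imap p q (alpha : mono p q) (m : Iset p) : Iset q :=
  [ffun a => extend alpha (m a) : 'I_(Mtop a q).+1].

Lemma top_dimP (a : 'I_k) : top_dim <= (tnth s a).-1.
Proof.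
rewrite /top_dim -!subn1 leq_sub2r //.
have: tnth s a \in (s : seq nat) by apply: mem_tnth.
elim: (s : seq nat) (head 0 s) => //= x r IHr x0.
rewrite inE big_cons => /orP[/eqP->|/(IHr x0)]; first exact: geq_minl.
by apply: leq_trans; apply: geq_minr.
Qed.

Lemma top_dim_reached : 0 < k -> exists a : 'I_k, top_dim = (tnth s a).-1.
Proof.
move=> k_gt0; rewrite /top_dim.
have min_s (r : seq nat) x0 : x0 \in (s : seq nat) ->
    {subset r <= (s : seq nat)} -> \big[minn/x0]_(m <- r) m \in (s : seq nat).
  elim: r => [|x r IHr] s0 sub_rs; first by rewrite big_nil.
  rewrite big_cons /minn; case: ifP => _; first by apply: sub_rs; rewrite inE eqxx.
  by apply: IHr => // y ry; apply: sub_rs; rewrite inE ry orbT.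
have s0: head 0 s \in (s : seq nat).
  have := size_tuple s; case: (tval s) => [|x r] //=; last by rewrite inE eqxx.
  by move=> k0; rewrite -k0 in k_gt0.
by have /tnthP[a ->] := min_s s _ s0 (fun _ => id); exists a.
Qed.

Lemma Imap_id p (m : Iset p) : Imap (mono_id p) m = m.
Proof.
apply/ffunP=> a; rewrite ffunE; apply/val_inj=> /=; rewrite /extend_nat.
case: (leqP (m a) p) => [le_mp|lt_pm]; first by rewrite ffunE inordK.
by rewrite subnK // ltnW.
Qed.

Lemma Imap_comp p q r (g : mono q r) (f : mono p q) (m : Iset p) :
  Imap (mono_comp g f) m = Imap g (Imap f m).
Proof.
apply/ffunP=> a; rewrite !ffunE; apply/val_inj=> /=; rewrite /extend_nat.
case: (leqP (m a) p) => [le_mp|lt_pm]; first by rewrite -ltnS ltn_ord inord_val ffunE.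
by rewrite ifN ?addnK // -ltnNge -[X in X < _]add0n ltn_add2r subn_gt0.
Qed.

(* On each factor: delta_i^(M_a(q+1)) : [M_a(q)] -> [M_a(q+1)] *)
Lemma Imap_coface q (i : 'I_q.+2) (m : Iset q) (a : 'I_k) :
  Imap (coface i) m a = bump i (m a) :> nat.
Proof.
rewrite ffunE /= /extend_nat; case: (leqP (m a) q) => [le_mq|lt_qm].
  by rewrite ffunE /= inordK.
by rewrite addnS subnK ?(ltnW lt_qm) // /bump (leq_trans _ lt_qm) // -ltnS.
Qed.

(* On each factor: sigma_i^(M_a(q)) : [M_a(q+1)] -> [M_a(q)] *)
Lemma Imap_codegen q (i : 'I_q.+1) (m : Iset q.+1) (a : 'I_k) :
  Imap (codegen i) m a = unbump i (m a) :> nat.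
Proof.
rewrite ffunE /= /extend_nat; case: (leqP (m a) q.+1) => [le_mq|lt_qm].
  by rewrite ffunE /= inordK.
move: (nat_of_ord (m a)) lt_qm => x lt_qx.
rewrite /unbump (leq_trans (ltn_ord i)) ?(ltnW (ltnW lt_qx)) //; last exact: ltnW.
by rewrite subn1 subnS -subn1 -(subn1 x); lia.
Qed.

Lemma Imap_unique (F : forall p q, mono p q -> Iset p -> Iset q) :
  (forall p m, F p p (mono_id p) m = m) ->
  (forall p q r (g : mono q r) (f : mono p q) m,
     F p r (mono_comp g f) m = F q r g (F p q f m)) ->
  (forall q (i : 'I_q.+2) m a, F q q.+1 (coface i) m a = bump i (m a) :> nat) ->
  (forall q (i : 'I_q.+1) m a, F q.+1 q (codegen i) m a = unbump i (m a) :> nat) ->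
  forall p q (f : mono p q) m, F p q f m = Imap f m.
Proof.
move=> Fid Fcomp Fcoface Fcodegen; apply: mono_gen_ind.
- by move=> p m; rewrite Fid Imap_id.
- by move=> p q r g f Fg Ff m; rewrite Fcomp Imap_comp Ff Fg.
- by move=> q i m; apply/ffunP=> a; apply/val_inj; rewrite /= Fcoface Imap_coface.
- by move=> q i m; apply/ffunP=> a; apply/val_inj; rewrite /= Fcodegen Imap_codegen.
Qed.

End Format.

Local Open Scope ring_scope.

(* The K-vector space with basis B *)
Notation freevect K B := {ffun B -> K^o}.

Definition bvect (K : fieldType) (B : finType) (b : B) : freevect K B :=
  [ffun b' => (b' == b)%:R].

Lemma freevect_sum (K : fieldType) (B : finType) (x : freevect K B) :
  x = \sum_b x b *: bvect K b.
Proof.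
apply/ffunP=> b; rewrite sum_ffunE (bigD1 b) //= !ffunE eqxx [_ *: _]mulr1.
by rewrite big1 ?addr0 // => c c_b; rewrite !ffunE eq_sym (negPf c_b) [_ *: _]mulr0.
Qed.

Notation chain K n p := (freevect K (mono p n)).

Definition face_fun (K : fieldType) (n q : nat) (i : 'I_q.+2)
    (x : chain K n q.+1) : chain K n q :=
  \sum_(alpha : mono q.+1 n) x alpha *: bvect K (mono_comp alpha (coface i)).

Fact face_fun_linear (K : fieldType) n q (i : 'I_q.+2) : linear (@face_fun K n q i).
Proof.
move=> c x y; rewrite /face_fun scaler_sumr -big_split /=; apply: eq_bigr => alpha _.
by rewrite !ffunE scalerDl scalerA.
Qed.
HB.instance Definition _ (K : fieldType) n q (i : 'I_q.+2) :=
  GRing.isLinear.Build K (chain K n q.+1) (chain K n q) _ (@face_fun K n q i)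
    (@face_fun_linear K n q i).

(* d_i : C_(q+1) -> C_q *)
Definition face (K : fieldType) n q (i : 'I_q.+2) : 'Hom(chain K n q.+1, chain K n q) :=
  linfun (@face_fun K n q i).

Lemma face_bvect (K : fieldType) n q (i : 'I_q.+2) (alpha : mono q.+1 n) :
  face K n i (bvect K alpha) = bvect K (mono_comp alpha (coface i)).
Proof.
rewrite lfunE /= /face_fun (bigD1 alpha) //= ffunE eqxx scale1r big1 ?addr0 //.
by move=> beta nb; rewrite ffunE (negPf nb) scale0r.
Qed.

Definition tensor_mx (k : nat) (s : k.-tuple nat) (F : fieldType)
    (T : Iset s (top_dim s) -> F) (p : nat) :
    'M[F]_(#|{: Iset s p}|, #|{: mono p (top_dim s)}|) :=
  \matrix_(i, j) T (Imap (enum_val j) (enum_val i)).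

(* T(u) = v_u, as an element of the function field K(v_u : u in I_n) *)
Definition generic_tensor (K : fieldType) (k : nat) (s : k.-tuple nat)
    (u : Iset s (top_dim s)) :
    {fraction {mpoly K[#|{: Iset s (top_dim s)}|]}} :=
  tofrac 'X_(enum_rank u).

(* R'_p *)
Definition generic_rank (K : fieldType) (k : nat) (s : k.-tuple nat) (p : nat)
    : nat :=
  \rank (tensor_mx (@generic_tensor K k s) p).

Lemma dim_chain (K : fieldType) n p :
  \dim {: chain K n p} = #|{: mono p n}|.
Proof. by rewrite dimvf /dim /= muln1. Qed.

Lemma generic_rank_le (K : fieldType) k (s : k.-tuple nat) p :
  (generic_rank K s p <= \dim {: chain K (top_dim s) p})%N.
Proof. by rewrite dim_chain rank_leq_col. Qed.

(* K'_p = S_p - R'_p with S_p = dim C_p; the truncated subtraction is exact by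
   [generic_rank_le]. *)
Definition Kdim (K : fieldType) (k : nat) (s : k.-tuple nat) (p : nat) : nat :=
  (\dim {: chain K (top_dim s) p} - generic_rank K s p)%N.

Definition Gr (K : fieldType) (r : nat) (V : vectType K) :=
  {L : {vspace V} | \dim L == r}.

(* A linear subspace of [proj V] is the set of the lines contained in some
   W : {vspace V} (the empty subspace being W = 0). *)
Definition proj (K : fieldType) (V : vectType K) := Gr 1 V.

Lemma line_subproof (K : fieldType) (V : vectType K) (v : V) :
  v != 0 -> \dim <[v]> == 1%N.
Proof. by move=> nz_v; rewrite dim_vline nz_v. Qed.
Definition line (K : fieldType) (V : vectType K) (v : V) (nz_v : v != 0) :
  proj V := Sub <[v]>%VS (line_subproof nz_v).

Definition subsets (B : finType) (r : nat) := {A : {set B} | #|A| == r}.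
HB.instance Definition _ B r := Finite.on (subsets B r).

Definition subset_elt (B : finType) (r : nat) (A : subsets B r) (j : 'I_r) : B :=
  enum_val (cast_ord (esym (eqP (valP A))) j).

(* The r-th exterior power of the space with basis B: its basis vector indexed
   by A = {a_1 < ... < a_r} stands for a_1 /\ ... /\ a_r (elements of B being
   ordered by [enum]). *)
Notation extpow K B r := (freevect K (subsets B r)).

Section Pluecker.
Variables (K : fieldType) (B : finType) (r : nat).

(* b_1 /\ ... /\ b_r; its coordinates are the maximal minors *)
Definition wedge (b : seq (freevect K B)) : extpow K B r :=
  [ffun A : subsets B r => \det (\matrix_(i < r, j < r) b`_i (subset_elt A j))].

Lemma wedge_neq0 (b : r.-tuple (freevect K B)) : free b -> wedge b != 0.
Proof.
move=> free_b.
pose M := \matrix_(i < r, j < #|B|) (b`_i (enum_val j) : K).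
have freeM : row_free M.
  rewrite -kermx_eq0; apply/eqP/row_matrixP=> l; rewrite row0.
  have: row l (kermx M) *m M = 0 by rewrite -row_mul mulmx_ker row0.
  move: (row l _) => v vM0; apply/rowP=> i; rewrite mxE.
  have /freeP/(_ (fun i => v 0 i)) freebP := free_b.
  apply: freebP; apply/ffunP=> x; rewrite [RHS]ffunE.
  have /rowP/(_ (enum_rank x)) := vM0; rewrite !mxE => <-.
  by rewrite sum_ffunE; apply: eq_bigr => j _; rewrite !ffunE !mxE enum_rankK.
have fullMT : row_full M^T by rewrite /row_full mxrank_tr.
pose f := fullrankfun fullMT.
have f_inj : injective f by apply: fullrankfun_inj.
have fvK : injective (fun i => enum_val (f i) : B) by move=> i j /enum_val_inj/f_inj.
pose A0 := [set enum_val (f i) | i : 'I_r].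
have cA : #|A0| == r by rewrite card_imset // card_ord.
pose A : subsets B r := Sub A0 cA.
have eltA j : exists i, subset_elt A j = enum_val (f i).
  have: subset_elt A j \in A0 by exact: enum_valP.
  by case/imsetP=> i _ ->; exists i.
have /fin_all_exists[h hE] := eltA.
have h_inj : injective h.
  move=> i j eq_h; have: subset_elt A i = subset_elt A j by rewrite !hE eq_h.
  by move/enum_val_inj/cast_ord_inj.
apply: contraTneq isT => w0.
have: wedge b A = 0 by rewrite w0 ffunE.
rewrite ffunE.
have -> : (\matrix_(i < r, j < r) b`_i (subset_elt A j)) =
   col_perm (perm h_inj) (rowsub f M^T)^T.
  by apply/matrixP=> i j; rewrite !mxE permE hE.
move/eqP; rewrite col_permE det_mulmx det_tr det_perm mulf_eq0 signr_eq0 orbF.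
have := fullrowsub_unit fullMT; rewrite -/f.
by rewrite unitmxE unitfE => /negPf->.
Qed.

Lemma wedge_vbasis_neq0 (L : Gr r (freevect K B)) : wedge (vbasis (val L)) != 0.
Proof.
case: L => L /= /eqP dL; have := vbasisP L; case: (vbasis L) => b sz /=.
have szr : size b == r by rewrite -dL.
by move/basis_free; apply: (@wedge_neq0 (Tuple szr)).
Qed.

(* The Pluecker embedding; independent of the basis by [plueckerE] *)
Definition pluecker (L : Gr r (freevect K B)) : proj (extpow K B r) :=
  line (wedge_vbasis_neq0 L).

Lemma plueckerE (L : Gr r (freevect K B)) (b : r.-tuple (freevect K B)) :
  basis_of (val L) b -> val (pluecker L) = <[wedge b]>%VS.
Proof.
move=> bL; have nz := wedge_neq0 (basis_free bL); rewrite /pluecker /=.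
apply/eqP; rewrite eqEdim !dim_vline nz wedge_vbasis_neq0 leqnn andbT -memvE.
pose c := \matrix_(i < r, j < r) (coord b j (vbasis (val L))`_i).
suff -> : wedge (vbasis (val L)) = \det c *: wedge b by rewrite memvZ // memv_line.
apply/ffunP=> A; rewrite !ffunE [_ *: _]/= /GRing.scale /= -det_mulmx.
congr (\det _); apply/matrixP=> i j; rewrite !mxE.
have vL : (vbasis (val L))`_i \in val L.
  by apply: vbasis_mem; rewrite mem_nth // size_tuple (eqP (valP L)).
rewrite {1}(coord_basis bL vL) sum_ffunE; apply: eq_bigr => l _.
by rewrite !mxE !ffunE.
Qed.

End Pluecker.

(* The tensor product of the spaces with bases (B j)_j: its basis vector
   indexed by (b_j)_j stands for the tensor product of the b_j. *)
Notation tensor_space K B := (freevect K {dffun forall j, B j}).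

Section Segre.
Variables (K : fieldType) (J : finType) (B : J -> finType).

Definition pure_tensor (x : forall j, freevect K (B j)) : tensor_space K B :=
  [ffun f : {dffun forall j, B j} => \prod_j x j (f j)].

Lemma pure_tensor_neq0 x : (forall j, x j != 0) -> pure_tensor x != 0.
Proof.
move=> nz_x.
have ex j : exists b, x j b != 0.
  apply/existsP; apply: contraNT (nz_x j) => /existsPn x0.
  by apply/eqP/ffunP=> b; rewrite ffunE; apply/eqP; have := x0 b; rewrite negbK.
pose f : {dffun forall j, B j} := [ffun j => xchoose (ex j)].
apply: contraTneq isT => /ffunP/(_ f); rewrite !ffunE => /eqP.
rewrite prodf_seq_eq0 => /hasP[j _] /=; rewrite ffunE.
by rewrite (negPf (xchooseP (ex j))).
Qed.

Lemma pure_tensor_vpick_neq0 (l : forall j, proj (freevect K (B j))) :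
  pure_tensor (fun j => vpick (val (l j))) != 0.
Proof.
apply: pure_tensor_neq0 => j; rewrite vpick0 -dimv_eq0.
by rewrite (eqP (valP (l j))).
Qed.

(* The Segre embedding; independent of the representatives by [segreE] *)
Definition segre (l : forall j, proj (freevect K (B j))) : proj (tensor_space K B) :=
  line (pure_tensor_vpick_neq0 l).

Lemma segreE (x : forall j, freevect K (B j)) (nz_x : forall j, x j != 0) :
  val (segre (fun j => line (nz_x j))) = <[pure_tensor x]>%VS.
Proof.
rewrite /segre /=; apply/eqP; rewrite eqEdim !dim_vline.
rewrite (pure_tensor_vpick_neq0 (fun j => line (nz_x j))).
rewrite pure_tensor_neq0 // leqnn andbT -memvE.
have ex j : exists c, vpick <[x j]> = c *: x j by apply/vlineP/memv_pick.
have /fin_all_exists[c cE] := ex.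
apply/vlineP; exists (\prod_j c j).
apply/ffunP=> f; rewrite !ffunE [_ *: _]/= /GRing.scale /= -big_split /=.
by apply: eq_bigr => j _; rewrite cE ffunE.
Qed.

End Segre.

Section Incidence.
Variables (K : fieldType) (k : nat) (s : k.-tuple nat).

Definition degrees := {p : 'I_(top_dim s).+1 | (0 < Kdim K s p)%N}.
HB.instance Definition _ := Finite.on degrees.

Definition GrS :=
  forall j : degrees, Gr (Kdim K s (val j)) (chain K (top_dim s) (val j)).

(* L_p, with L_p = 0 if K'_p = 0 *)
Definition component (L : GrS) (p : 'I_(top_dim s).+1) :
    {vspace chain K (top_dim s) p} :=
  if @idP (0 < Kdim K s p)%N is ReflectT Kp_gt0
  then val (L (exist _ p Kp_gt0)) else 0%VS.

(* The pair (q+1, q) plays the role of (p, p-1). *)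
Definition GrSimp (L : GrS) : Prop :=
  forall (q : 'I_(top_dim s)) (i : 'I_q.+2), (0 < Kdim K s q.+1)%N ->
  (face K (top_dim s) i @: component L (lift ord0 q)
     <= component L (widen_ord (leqnSn (top_dim s)) q))%VS.

Definition ambient :=
  tensor_space K (fun j : degrees =>
    subsets (mono (val j) (top_dim s)) (Kdim K s (val j))).

Definition Sigma (L : GrS) : proj ambient := segre (fun j => pluecker (L j)).

End Incidence.

(* Main.v *)
(* Let x be a basis of a subspace L with Plücker coordinates the maximal minors
   of x.  Replacing column l of an r x r submatrix x_h by a variable column b
   gives, as b varies, the coordinates of the vector (adj(x_h) x)_l of L, and
   these vectors span L as soon as det x_h <> 0.  By Cramer's rule, a vector v
   lies in the span of y iff det(y_h) v = sum_l v_(h l) (adj(y_h) y)_l for all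
   (equivalently, for one nondegenerate) h.  So f(L) <= L' amounts to equations
   that are bilinear in the Plücker coordinates of L and L'; multiplied by all
   products of minors in the other factors they become linear in the Segre
   coordinates, and no solution is added since each factor has a nonzero minor. *)
Require Import Defs.
From HB Require Import structures.
From mathcomp Require Import all_boot all_order all_fingroup all_algebra.

Set Implicit Arguments.
Unset Strict Implicit.
Unset Printing Implicit Defensive.

Import GRing.Theory.
Local Open Scope ring_scope.

(** * Products of sums and coefficients in a span *)

(** Distributivity over a dependent family of index types: it turns a product of linear forms, one
    per factor, into one linear form on pure tensors. *)
Lemma sum_dffun_prod (K : fieldType) (J : finType) (B : J -> finType)
    (F : forall j, B j -> K) :
  \prod_j (\sum_(b : B j) F j b) =
  \sum_(f : {dffun forall j, B j}) \prod_j F j (f j).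
Proof.
rewrite (reindex (@dffun_of_fprod J B)) /=; last first.
  exact/onW_bij/dffun_of_fprod_bij.
pose P j := [ffun b => F j b] : {ffun B j -> K}.
have := @big_fprod K 0 1 *%R +%R J B P.
have <- := bigA_distr_big_dep (zero := 0) (times := *%R) (plus := +%R)
  (fun j => [in tagged_with B j]) (fun j => untag 0 (P j)) => E.
transitivity (\sum_(t : fprod B) \prod_(i in J) P i (t i)).
  rewrite E; apply: eq_bigr => j _.
  by rewrite -(big_tag P); apply: eq_bigr => b _; rewrite ffunE.
by apply: eq_bigr => t _; apply: eq_bigr => j _; rewrite !ffunE.
Qed.

Lemma span_nth (K : fieldType) (V : vectType K) (r : nat) (X : seq V) (v : V) :
  size X = r -> v \in <<X>>%VS -> exists c : 'I_r -> K, v = \sum_i c i *: X`_i.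
Proof.
case: r / => /(@coord_span _ _ _ (in_tuple X)) ->.
by exists (fun i => coord (in_tuple X) i v).
Qed.

(** * Minors, Cramer's rule and Plücker coordinates *)

Section Minors.
Variables (K : fieldType) (B : finType) (r : nat).
Implicit Types (X : seq (freevect K B)) (h : 'I_r -> B) (y : freevect K B).

Lemma scale_freevectE (c : K) (y : freevect K B) b : (c *: y) b = c * y b.
Proof. by rewrite ffunE. Qed.

Definition column_mx X h : 'M[K]_r := \matrix_(i, j) X`_i (h j).
Definition minor X h : K := \det (column_mx X h).

Definition update h (l : 'I_r) (b : B) (j : 'I_r) : B :=
  if j == l then b else h j.

(** When [X] has [r] vectors this is, up to sign, the interior product of their wedge with the
    coordinate forms at [h j] for [j != l]. *)
Definition contraction X h (l : 'I_r) : freevect K B :=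
  \sum_i (\adj (column_mx X h)) l i *: X`_i.

(** Laplace expansion along column [l]: its cofactors do not see that column, so they are those of
    [column_mx X h]. *)
Lemma contractionE X h l b : contraction X h l b = minor X (update h l b).
Proof.
rewrite sum_ffunE /minor (expand_det_col _ l); apply: eq_bigr => i _.
rewrite scale_freevectE !mxE /update eqxx mulrC; congr (_ * (_ * \det _)).
by apply/matrixP=> i' j; rewrite !mxE /update eq_sym (negPf (neq_lift _ _)).
Qed.

Lemma contraction_span X h l : size X = r -> contraction X h l \in <<X>>%VS.
Proof.
move=> sX; apply: memv_suml => i _; apply/memvZ/memv_span/mem_nth.
by rewrite sX.
Qed.

(** Row [i] of [M *m \adj M = (\det M)%:M] for [M = column_mx X h], applied to the vectors of
    [X]. *)
Lemma cramer_contraction X h (i : 'I_r) :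
  \sum_l X`_i (h l) *: contraction X h l = minor X h *: X`_i.
Proof.
under eq_bigr do rewrite /contraction scaler_sumr.
rewrite exchange_big /=.
have E i' : \sum_l X`_i (h l) *: (\adj (column_mx X h) l i' *: X`_i') =
    (i == i')%:R * minor X h *: X`_i'.
  have -> : (i == i')%:R * minor X h = (column_mx X h *m \adj (column_mx X h)) i i'.
    by rewrite mul_mx_adj !mxE mulrC mulr_natr.
  rewrite mxE scaler_suml.
  by apply: eq_bigr => l _; rewrite scalerA [column_mx _ _ _ _]mxE.
under eq_bigr do rewrite E.
rewrite (bigD1 i) //= big1 ?addr0 ?eqxx ?mul1r // => i' ne_i'.
by rewrite eq_sym (negPf ne_i') mul0r scale0r.
Qed.

(** Both sides are linear in [y], which reduces to [cramer_contraction]. Degenerate [h] are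
    included, so an incident tuple will satisfy every equation. *)
Lemma span_contraction X h y : size X = r -> y \in <<X>>%VS ->
  minor X h *: y = \sum_l y (h l) *: contraction X h l.
Proof.
move=> sX /(span_nth sX)[c ->].
rewrite scaler_sumr.
under [RHS]eq_bigr => l _.
  rewrite sum_ffunE scaler_suml.
  under eq_bigr do rewrite scale_freevectE -scalerA.
  over.
rewrite exchange_big; apply: eq_bigr => i _ /=.
by rewrite -scaler_sumr cramer_contraction !scalerA mulrC.
Qed.

(** A repeated column gives zero; otherwise sorting the columns gives a signed Plücker coordinate.
    The coefficients are chosen before [X], so the minor is a linear form in the wedge. *)
Lemma minor_wedge h :
  exists c : subsets B r -> K, forall X, minor X h = \sum_A c A * wedge r X A.
Proof.
case: (boolP (injectiveb h)) => [/injectiveP inj_h|/injectivePn[l1 [l2 ne_l eq_h]]].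
  have cA : #|[set h l | l : 'I_r]| == r by rewrite card_imset // card_ord.
  pose A : subsets B r := exist _ [set h l | l : 'I_r] cA.
  have hA l : exists l', h l = subset_elt A l'.
    have hl : h l \in [set h l | l : 'I_r] by apply: imset_f.
    exists (cast_ord (eqP cA) (enum_rank_in hl (h l))).
    rewrite /subset_elt -[LHS](enum_rankK_in hl hl); congr enum_val.
    exact/val_inj.
  have [g gE] := fin_all_exists hA.
  have inj_g : injective g by move=> l l' eq_g; apply: inj_h; rewrite !gE eq_g.
  (* The sign is that of the permutation [g] taking the enumeration of the image of [h] to [h]. *)
  exists (fun A' => (A' == A)%:R * (-1) ^+ perm inj_g) => X.
  rewrite (bigD1 A) //= big1 ?addr0 => [|A' /negPf->]; last by rewrite !mul0r.
  rewrite eqxx mul1r ffunE mulrC -odd_permV -det_perm -det_mulmx -col_permE.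
  by congr (\det _); apply/matrixP=> i l; rewrite !mxE permE gE.
exists (fun=> 0) => X; rewrite big1 => [|A _]; last by rewrite mul0r.
rewrite /minor -det_tr; apply: (determinant_alternate ne_l) => i.
by rewrite !mxE eq_h.
Qed.

Lemma minor_neq0 X : wedge r X != 0 -> exists h, minor X h != 0.
Proof.
move=> nz; have [A nzA] : exists A, wedge r X A != 0.
  apply/existsP; apply: contraNT nz => /existsPn w0.
  by apply/eqP/ffunP=> A; rewrite [RHS]ffunE; apply/eqP; have := w0 A; rewrite negbK.
by exists (subset_elt A); move: nzA; rewrite ffunE.
Qed.

End Minors.

(** * Tests for images and membership by contractions *)

Lemma limg_freevectE (K : fieldType) (B1 B2 : finType)
    (f : 'Hom(freevect K B1, freevect K B2)) x b :
  f x b = \sum_a f (bvect K a) b * x a.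
Proof.
rewrite {1}(freevect_sum x) linear_sum sum_ffunE; apply: eq_bigr => a _.
by rewrite linearZ scale_freevectE mulrC.
Qed.

Section LimgContraction.
Variables (K : fieldType) (B1 B2 : finType) (r1 r2 : nat).
Variable f : 'Hom(freevect K B1, freevect K B2).
Variables (X : seq (freevect K B1)) (h1 : 'I_r1 -> B1).
Hypotheses (sX : size X = r1) (nz1 : minor X h1 != 0).

(** Dividing Cramer's identity by the nonzero minor shows that the contractions span [<<X>>]. *)
Lemma limg_contraction_subv (U : {vspace freevect K B2}) :
  (forall l, f (contraction X h1 l) \in U) -> (f @: <<X>> <= U)%VS.
Proof.
move=> fU; rewrite limg_span; apply/span_subvP => _ /mapP[x /(nthP 0)[i lt_i <-] ->].
rewrite sX in lt_i.
rewrite -[X`_i]scale1r -(mulVf nz1) -scalerA linearZ; apply: memvZ.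
rewrite -(cramer_contraction X h1 (Ordinal lt_i)) linear_sum memv_suml // => l _.
by rewrite linearZ; apply/memvZ/fU.
Qed.

Variables (Y : seq (freevect K B2)) (h2 : 'I_r2 -> B2).
Hypotheses (sY : size Y = r2) (nz2 : minor Y h2 != 0).

(** Converse of [span_contraction] at a single nondegenerate [h2]. *)
Lemma mem_span_contraction (y : freevect K B2) :
  minor Y h2 *: y = \sum_l y (h2 l) *: contraction Y h2 l -> y \in <<Y>>%VS.
Proof.
move=> Ey; rewrite -[y]scale1r -(mulVf nz2) -scalerA Ey; apply: memvZ.
by apply: memv_suml => l _; apply/memvZ/contraction_span.
Qed.

End LimgContraction.

(** * Conditions linear in the Segre coordinates *)

Section CoordinateForm.
Variables (K : fieldType) (B : finType) (a : B -> K).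

Definition coordinate_form (t : freevect K B) : K^o := \sum_b a b * t b.

Fact coordinate_form_linear : linear coordinate_form.
Proof.
move=> c t u; rewrite /coordinate_form scaler_sumr -big_split; apply: eq_bigr => b _.
by rewrite !ffunE mulrDr mulrCA.
Qed.
HB.instance Definition _ :=
  GRing.isLinear.Build K (freevect K B) K^o _ coordinate_form coordinate_form_linear.

End CoordinateForm.

Section LinearSections.
Variables (K : fieldType) (J : finType) (B : J -> finType) (r : J -> nat).
Implicit Type L : forall j, Gr (r j) (freevect K (B j)).

Definition basis_seq L j : seq (freevect K (B j)) := vbasis (val (L j)).

Definition pluecker_segre L := segre (fun j => pluecker (L j)).

Definition pluecker_tensor L := pure_tensor (fun j => wedge (r j) (basis_seq L j)).

Lemma pluecker_segreE L : val (pluecker_segre L) = <[pluecker_tensor L]>%VS.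
Proof. exact: segreE. Qed.

Definition linear_section (C : (forall j, Gr (r j) (freevect K (B j))) -> Prop) :=
  exists W : {vspace tensor_space K (fun j => subsets (B j) (r j))},
    forall L, C L <-> (val (pluecker_segre L) <= W)%VS.

(** The values depend on the representative [pluecker_tensor L] of the Segre point; only their
    vanishing is geometric. *)
Definition tensor_form (F : (forall j, Gr (r j) (freevect K (B j))) -> K) :=
  exists phi : 'Hom(tensor_space K (fun j => subsets (B j) (r j)), K^o),
    forall L, F L = phi (pluecker_tensor L).

Lemma linear_section_ext C C' :
  (forall L, C L <-> C' L) -> linear_section C -> linear_section C'.
Proof. by move=> eqC [W WE]; exists W => L; rewrite -eqC. Qed.

Lemma linear_sectionT : linear_section (fun=> True).
Proof. by exists fullv => L; split=> // _; apply: subvf. Qed.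

Lemma linear_section_forall (I : finType) C :
  (forall i : I, linear_section (C i)) -> linear_section (fun L => forall i, C i L).
Proof.
move=> /fin_all_exists[W WE]; exists (\bigcap_i W i)%VS => L.
split=> [CL | /subv_bigcapP sLW i]; last exact/WE/sLW.
by apply/subv_bigcapP => i _; apply/WE.
Qed.

Lemma linear_section_form F : tensor_form F -> linear_section (fun L => F L = 0).
Proof.
by case=> phi phiE; exists (lker phi) => L; rewrite pluecker_segreE phiE -memvE memv_ker;
   split=> [->|/eqP].
Qed.

Lemma tensor_form_sum (I : finType) F :
  (forall i : I, tensor_form (F i)) -> tensor_form (fun L => \sum_i F i L).
Proof.
move=> /fin_all_exists[phi phiE]; exists (\sum_i phi i) => L.
by rewrite sum_lfunE; apply: eq_bigr => i _.
Qed.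

Lemma tensor_formZ c F : tensor_form F -> tensor_form (fun L => c * F L).
Proof. by case=> phi phiE; exists (c *: phi) => L; rewrite scale_lfunE phiE. Qed.

Lemma tensor_formB F G :
  tensor_form F -> tensor_form G -> tensor_form (fun L => F L - G L).
Proof.
by case=> phi phiE [psi psiE]; exists (phi - psi) => L; rewrite !lfunE /= phiE psiE lfunE.
Qed.

(** Each minor is a linear form in the wedge of its factor, with coefficients independent of [L];
    multiplying these forms out gives a form on the tensor space. *)
Lemma tensor_form_minors (H : forall j, 'I_(r j) -> B j) :
  tensor_form (fun L => \prod_j minor (basis_seq L j) (H j)).
Proof.
have /fin_all_exists[c cE] j := minor_wedge K (H j).
pose a (f : {dffun forall j, subsets (B j) (r j)}) := \prod_j c j (f j).
exists (linfun (coordinate_form a)) => L; rewrite lfunE /=.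
under eq_bigr do rewrite cE.
rewrite sum_dffun_prod; apply: eq_bigr => f _.
by rewrite ffunE -big_split.
Qed.

Lemma basis_seq_span L j : <<basis_seq L j>>%VS = val (L j).
Proof. exact/span_basis/vbasisP. Qed.

Lemma size_basis_seq L j : size (basis_seq L j) = r j.
Proof. by rewrite size_tuple (eqP (valP (L j))). Qed.

Lemma basis_seq_minor_neq0 L j :
  exists h, minor (basis_seq L j) (h : 'I_(r j) -> B j) != 0.
Proof. exact/minor_neq0/wedge_vbasis_neq0. Qed.

Implicit Type H : forall j, 'I_(r j) -> B j.

Definition update_family H j (l : 'I_(r j)) b : forall j', 'I_(r j') -> B j' :=
  dfwith H (update (H j) l b).

Definition minor_prod L H (P : pred J) := \prod_(j | P j) minor (basis_seq L j) (H j).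

(* A finite type of choices, as required by [linear_section_forall] *)
Definition column_choice := {dffun forall j, {ffun 'I_(r j) -> B j}}.

Definition column_choice_fun (H : column_choice) j : 'I_(r j) -> B j := H j.
Arguments column_choice_fun : clear implicits.

(** The nondegenerate choice varies with [L], hence the equations below are imposed for all [H]. *)
Lemma column_choice_neq0 L :
  exists H : column_choice, forall j, minor (basis_seq L j) (column_choice_fun H j) != 0.
Proof.
have /fin_all_exists[h hP] : forall j, exists h : {ffun 'I_(r j) -> B j},
    minor (basis_seq L j) h != 0.
  move=> j; have [h nz_h] := basis_seq_minor_neq0 L j; exists (finfun h).
  rewrite /minor (_ : column_mx _ _ = column_mx (basis_seq L j) h) //.
  by apply/matrixP=> i l; rewrite !mxE ffunE.
by exists [ffun j => h j] => j; rewrite /column_choice_fun ffunE.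
Qed.

Lemma minor_prod_neq0 L H P :
  (forall j, minor (basis_seq L j) (H j) != 0) -> minor_prod L H P != 0.
Proof. by move=> nzH; apply/prodf_neq0 => j _; apply: nzH. Qed.

(** * Inclusions between factors as linear sections *)

Section ImageOfFactor.
Variables (j1 : J) (B2 : finType) (f : 'Hom(freevect K (B j1), freevect K B2)).

(** By [contractionE] the varying minor at [j1] is a coordinate of the contraction; the minors at
    the other factors are constant in [a] and come out of the sum. *)
Lemma minor_prod_contraction L H (l : 'I_(r j1)) b :
  \sum_a f (bvect K a) b * minor_prod L (update_family H l a) predT =
  f (contraction (basis_seq L j1) (H j1) l) b * minor_prod L H (predC1 j1).
Proof.
rewrite limg_freevectE mulr_suml; apply: eq_bigr => a _.
rewrite /minor_prod (bigD1 j1) //= /update_family dfwith_in contractionE mulrA.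
congr (_ * _).
by apply: eq_bigr => j ne_j; rewrite dfwith_out // eq_sym.
Qed.

(** Serves the case where the target component is zero and has no Grassmannian factor. *)
Lemma linear_section_limg0 : linear_section (fun L => (f @: val (L j1) <= 0)%VS).
Proof.
pose E H (l : 'I_(r j1)) b L :=
  \sum_a f (bvect K a) b * minor_prod L (update_family H (j := j1) l a) predT.
apply: (@linear_section_ext (fun L =>
  forall (H : column_choice) l b, E (column_choice_fun H) l b L = 0)) => [L|]; last first.
  apply: linear_section_forall => H; apply: linear_section_forall => l.
  apply: linear_section_forall => b; apply: linear_section_form.
  by apply: tensor_form_sum => a; apply/tensor_formZ/tensor_form_minors.
rewrite -basis_seq_span; split=> [E0 | /subvP f0 H l b].
  have [H nzH] := column_choice_neq0 L.
  apply: (limg_contraction_subv (size_basis_seq L j1) (nzH j1)) => l.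
  rewrite memv0; apply/eqP/ffunP => b; rewrite [RHS]ffunE.
  have /eqP := E0 H l b; rewrite /E minor_prod_contraction mulf_eq0.
  by rewrite (negPf (minor_prod_neq0 _ nzH)) orbF => /eqP.
rewrite /E minor_prod_contraction.
have /f0 : f (contraction (basis_seq L j1) (column_choice_fun H j1) l)
    \in (f @: <<basis_seq L j1>>)%VS.
  by apply/memv_img/contraction_span/size_basis_seq.
by rewrite memv0 => /eqP->; rewrite ffunE mul0r.
Qed.

End ImageOfFactor.

(** Cramer's membership equation is bilinear in the minors at [j1] and [j2]. Since these factors are
    distinct, multiplying by minors at all the others makes it a tensor form. *)
Lemma linear_section_incidence (j1 j2 : J)
    (f : 'Hom(freevect K (B j1), freevect K (B j2))) (ne_j : j1 != j2) :
  linear_section (fun L => (f @: val (L j1) <= val (L j2))%VS).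
Proof.
(* [E1] and [E2] are coordinate [b] of the two sides of Cramer's equation for the image of a
   contraction, times the minors at the factors other than [j1] and [j2]. *)
pose E1 H (l : 'I_(r j1)) b L :=
  \sum_a f (bvect K a) b * minor_prod L (update_family H (j := j1) l a) predT.
pose E2 H (l : 'I_(r j1)) b L :=
  \sum_l' \sum_a f (bvect K a) (H j2 l') *
    minor_prod L (update_family (update_family H (j := j2) l' b) (j := j1) l a) predT.
pose E H l b L := E1 H l b L - E2 H l b L.
pose rest L H := minor_prod L H (predD1 (predC1 j1) j2).
have restE H L : minor_prod L H (predC1 j1) = minor (basis_seq L j2) (H j2) * rest L H.
  rewrite /rest /minor_prod (bigD1 j2) /=; last by rewrite eq_sym.
  congr (_ * _).
  by apply: eq_bigl => j; rewrite /= andbC.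
have EE H l b L (y := f (contraction (basis_seq L j1) (H j1) l)) :
    E H l b L = ((minor (basis_seq L j2) (H j2) *: y) b -
     (\sum_l' y (H j2 l') *: contraction (basis_seq L j2) (H j2) l') b) * rest L H.
  rewrite /E /E1 /E2 minor_prod_contraction -/y mulrBl scale_freevectE restE.
  congr (_ - _); first by rewrite mulrA [y b * _]mulrC.
  rewrite sum_ffunE mulr_suml; apply: eq_bigr => l' _.
  rewrite minor_prod_contraction scale_freevectE contractionE restE mulrA.
  (* The update at [j2] leaves [H j1] alone, so the same [y] reappears. *)
  rewrite /update_family dfwith_out 1?eq_sym // -/y dfwith_in; congr (_ * _).
  by apply: eq_bigr => j /andP[ne_j2 _]; rewrite dfwith_out // eq_sym.
apply: (@linear_section_ext (fun L =>
  forall (H : column_choice) l b, E (column_choice_fun H) l b L = 0)) => [L|]; last first.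
  apply: linear_section_forall => H; apply: linear_section_forall => l.
  apply: linear_section_forall => b; apply: linear_section_form.
  apply: tensor_formB.
    by apply: tensor_form_sum => a; apply/tensor_formZ/tensor_form_minors.
  apply: tensor_form_sum => l'.
  by apply: tensor_form_sum => a; apply/tensor_formZ/tensor_form_minors.
rewrite -!basis_seq_span; split=> [E0 | /subvP sfX H l b].
  (* One [H] nondegenerate at every factor suffices: its extra minors cancel, and those at [j1] and
     [j2] permit both contraction tests. *)
  have [H nzH] := column_choice_neq0 L.
  apply: (limg_contraction_subv (size_basis_seq L j1) (nzH j1)) => l.
  apply: (mem_span_contraction (size_basis_seq L j2) (nzH j2)).
  apply/ffunP => b; apply/eqP; rewrite -subr_eq0.
  have /eqP := E0 H l b; rewrite EE mulf_eq0.
  by rewrite (negPf (minor_prod_neq0 _ nzH)) orbF.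
rewrite EE -(span_contraction _ (size_basis_seq L j2)) ?subrr ?mul0r //.
by apply/sfX/memv_img/contraction_span/size_basis_seq.
Qed.

End LinearSections.

(** * Components of a tuple and the incidence variety *)

Section Component.
Variables (K : fieldType) (k : nat) (s : k.-tuple nat).

(** The positivity proof supplied by [idP] equals the one stored in [j] by proof irrelevance for
    boolean equalities. *)
Lemma component_degree (L : GrS K s) (j : degrees K s) : component L (val j) = val (L j).
Proof.
case: j => p Kp_gt0; rewrite /component /=.
by case: {-}_ / idP => // Kp; rewrite (bool_irrelevance Kp Kp_gt0).
Qed.

Lemma component_eq0 (L : GrS K s) (p : 'I_(top_dim s).+1) :
  Kdim K s p = 0%N -> component L p = 0%VS.
Proof.
by move=> Kp0; rewrite /component; case: {-}_ / idP => // Kp; exfalso; rewrite Kp0 in Kp.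
Qed.

End Component.

Theorem proposition8p14 (K : fieldType) (K_infinite : infinite_type K)
    (k : nat) (k_ge1 : (1 <= k)%N)
    (s : k.-tuple nat) (s_gt0 : forall a : 'I_k, (0 < tnth s a)%N) :
  exists W : {vspace ambient K s}, forall x : proj (ambient K s),
    (exists L : GrS K s, GrSimp L /\ x = Sigma L) <->
    (exists L : GrS K s, x = Sigma L) /\ (val x <= W)%VS.
Proof.
suff [W WE] : linear_section (@GrSimp K k s).
  exists W => x; split=> [[L [simpL ->]] | [[L ->]]].
    by split; [exists L | apply/WE].
  by move=> /WE simpL; exists L.
apply: linear_section_forall => q; apply: linear_section_forall => i.
(* The condition is vacuous when the source has no factor; otherwise the target is either zero or
   another factor. *)
have [_|Kp_gt0] := posnP (Kdim K s q.+1).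
  by apply: linear_section_ext (linear_sectionT _ _ _) => L; split.
pose j1 : degrees K s := exist _ (lift ord0 q) Kp_gt0.
pose p2 := widen_ord (leqnSn (top_dim s)) q.
have compE L : component L (lift ord0 q) = val (L j1) by rewrite -component_degree.
have [Kq0|Kq_gt0] := posnP (Kdim K s p2).
  apply: linear_section_ext (@linear_section_limg0 K (degrees K s)
    (fun j => mono (val j) (top_dim s)) (fun j => Kdim K s (val j)) j1 _
    (face K (top_dim s) i)) => L.
  by rewrite compE (component_eq0 L Kq0); split=> [|->].
pose j2 : degrees K s := exist _ p2 Kq_gt0.
have ne_j : j1 != j2 by rewrite -val_eqE -val_eqE /= neq_ltn ltnSn orbT.
apply: linear_section_ext (@linear_section_incidence K (degrees K s)
  (fun j => mono (val j) (top_dim s)) (fun j => Kdim K s (val j)) j1 j2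
  (face K (top_dim s) i) ne_j) => L.
by rewrite compE -(component_degree L j2); split=> [|->].
Qed.
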